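(* Let $d$ be a prime number. For $U\in \mathrm{U}(\mathcal{H}_{d})$ with $\det (U)=e^{\mathrm{i}\theta}$ for some $\theta\in(-\pi,\pi]$, let $U=ADA^{\dagger}$ where $A\in \mathrm{SU}(\mathcal{H}_{d})$ and $D$ is diagonal, and let $B\in \mathrm{SU}(\mathcal{H}_{d})$ be diagonal such that $B^d=e^{-\mathrm{i}\frac{\theta}{d}}D$. Then $\mathrm{C}^{2,0}_{1,2}(U)$ can be decomposed into $$\mathrm{C}^{2,0}_{1,2}(U)= (C \otimes A) \cdot [\mathrm{SUM} \cdot (I_d \otimes B)]^d \cdot (I_d \otimes A^{\dagger}),$$ where $C=e^{\mathrm{i}\frac{\theta}{d}}|d-1\rangle\langle d-1|+\sum_{a=0}^{d-2}|a\rangle\langle a|$.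
   Context: $\mathcal{H}_{d}$ is a $d$-dimensional complex Hilbert space with orthonormal (computational) basis $|0\rangle,\dots,|d-1\rangle$; ''diagonal'' means diagonal in this basis. $\mathrm{U}(\mathcal{H}_d)$ is the group of unitary operators on $\mathcal{H}_d$ and $\mathrm{SU}(\mathcal{H}_d)$ consists of those of determinant $1$; $I_d$ is the identity; $\dagger$ is the conjugate transpose. $X_d=|0\rangle\langle d-1|+\sum_{a=0}^{d-2}|a+1\rangle\langle a|$ and $\mathrm{SUM}=\sum_{a=0}^{d-1}|a\rangle\langle a|\otimes X_d^{a}$ on $\mathcal{H}_d\otimes\mathcal{H}_d$. $\mathrm{C}^{2,0}_{1,2}(U)\in\mathrm{U}(\mathcal{H}_d\otimes\mathcal{H}_d)$ is defined by $\mathrm{C}^{2,0}_{1,2}(U)|x_1x_2\rangle=|x_1\rangle\otimes U|x_2\rangle$ if $x_1=0$ and $\mathrm{C}^{2,0}_{1,2}(U)|x_1x_2\rangle=|x_1x_2\rangle$ otherwise.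
   Formalization: The gate C is corrected to e^{iθ/d}|0⟩⟨0| + Σ_{a=1}^{d-1}|a⟩⟨a|; as printed, with the phase on |d-1⟩, the identity fails whenever θ ≠ 0 (e.g. d=2, θ=π, A=I, U=diag(1,-1), B=diag(e^{-iπ/4},e^{iπ/4})). *)

(* Defs.v *)
From mathcomp Require Import all_boot all_order all_algebra.
From mathcomp Require Import complex mxtens.
From mathcomp Require Import reals trigo.

Set Implicit Arguments.
Unset Strict Implicit.
Unset Printing Implicit Defensive.

Import Order.TTheory GRing.Theory Num.Theory.
Local Open Scope ring_scope.
Local Open Scope complex_scope.
Local Open Scope sesquilinear_scope.

(* Operators on H_d are d x d matrices over R[i] acting on column vectors, and
   [A *t B] is the Kronecker product: H_d (x) H_d has dimension d * d, and
   |x1 x2> is the basis vector of index x1 * d + x2. *)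

Definition expi (R : realType) (t : R) : R[i] := cos t +i* sin t.

(* The zero vector when d <= a. *)
Definition ket (R : realType) (d a : nat) : 'cV[R[i]]_d :=
  \col_i (i == a :> nat)%:R.

Definition ketbra (R : realType) (d a b : nat) : 'M[R[i]]_d :=
  ket R d a *m (ket R d b)^t*.

Definition special_unitary (R : realType) (d : nat) (A : 'M[R[i]]_d) : Prop :=
  A \is unitarymx /\ \det A = 1.

Definition Xgate (R : realType) (d : nat) : 'M[R[i]]_d :=
  ketbra R d 0 d.-1 + \sum_(0 <= a < d.-1) ketbra R d a.+1 a.

Definition SUMgate (R : realType) (d : nat) : 'M[R[i]]_(d * d) :=
  \sum_(0 <= a < d) ketbra R d a a *t (Xgate R d) ^+ a.

(* Given column by column, i.e. by the images of the basis vectors |x1 x2>. *)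
Definition ctrl0 (R : realType) (d : nat) (U : 'M[R[i]]_d) : 'M[R[i]]_(d * d) :=
  \matrix_(i, j)
    let: (x1, x2) := mxtens_unindex j in
    (if x1 == 0 :> nat then ket R d x1 *t (U *m ket R d x2)
     else ket R d x1 *t ket R d x2) i ord0.

Lemma ctrl0_ket (R : realType) (d : nat) (U : 'M[R[i]]_d) (x1 x2 : 'I_d) :
  ctrl0 U *m (ket R d x1 *t ket R d x2) =
  if x1 == 0 :> nat then ket R d x1 *t (U *m ket R d x2)
  else ket R d x1 *t ket R d x2.
Proof.
apply/colP => i; rewrite mxE (bigD1 (mxtens_index (x1, x2))) //=.
rewrite big1 ?addr0 => [|k]; last first.
  case: (mxtens_indexP k) => k1 k2 /eqP neq_k.
  rewrite [X in _ * X]mxE !mxE !mxtens_indexK /= -natrM mulnb.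
  case: andP => [[/eqP/ord_inj e1 /eqP/ord_inj e2]|]; last by rewrite mulr0.
  by case: neq_k; rewrite e1 e2.
by rewrite !mxE !mxtens_indexK /= !eqxx !mulr1.
Qed.

(* The source prints this gate with the phase on |d-1>. Since ctrl0 applies U
   when x1 = 0, and the x1 = 0 block of [SUM (I (x) B)]^d is B^d, which equals
   e^(-i theta/d) D, the compensating phase has to sit on |0>; the identity with
   the phase on |d-1> fails whenever theta <> 0. *)
Definition Cgate (R : realType) (d : nat) (theta : R) : 'M[R[i]]_d :=
  expi (theta / d%:R) *: ketbra R d 0 0 + \sum_(1 <= a < d) ketbra R d a a.

(* Main.v *)
Require Import Defs.
From mathcomp Require Import all_boot all_order all_algebra.
From mathcomp Require Import complex mxtens.
From mathcomp Require Import reals trigo.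

Import Order.TTheory GRing.Theory Num.Theory.
Local Open Scope ring_scope.
Local Open Scope complex_scope.
Local Open Scope sesquilinear_scope.

(** The gate SUM (I (x) B) is block diagonal, acting as X^x B on the block of
    |x>. For x <> 0 the prime d is coprime to x, so d applications of X^x B
    carry every basis vector once around the whole basis and multiply it by
    det B = 1; conjugating by A leaves the identity. On the block x = 0 the d-th
    power is B^d = e^(-i theta/d) D, and the phase of C turns A B^d A^dagger
    into U. *)

Lemma mulmx_ketE (R : realType) (d m : nat) (M : 'M[R[i]]_(m, d)) (x : 'I_d) :
  M *m ket R d x = col x M.
Proof.
apply/colP => i; rewrite !mxE (bigD1 x) //= !mxE eqxx mulr1 big1 ?addr0 // => k.
by rewrite mxE => /negbTE; rewrite -val_eqE /= => ->; rewrite mulr0.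
Qed.

Lemma eq_mx_ket (R : realType) (d m : nat) (M N : 'M[R[i]]_(m, d)) :
  (forall x : 'I_d, M *m ket R d x = N *m ket R d x) -> M = N.
Proof.
move=> eqMN; apply/matrixP => i x; have := eqMN x.
by rewrite !mulmx_ketE => /colP/(_ i); rewrite !mxE.
Qed.

(** Product kets are exactly the computational basis of the tensor product, since [mxtens_index] is
    a bijection on indices. *)
Lemma eq_mx_ket_tens (R : realType) (d e m : nat) (M N : 'M[R[i]]_(m, d * e)) :
  (forall (x : 'I_d) (y : 'I_e),
     M *m (ket R d x *t ket R e y) = N *m (ket R d x *t ket R e y)) -> M = N.
Proof.
have tens_ket (x : 'I_d) (y : 'I_e) :
    ket R d x *t ket R e y = ket R (d * e) (mxtens_index (x, y)).
  apply/colP => k; case: (mxtens_indexP k) => k1 k2.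
  rewrite !mxE !mxtens_indexK /= -natrM mulnb; congr ((nat_of_bool _)%:R).
  apply/andP/eqP => [[/eqP/ord_inj -> /eqP/ord_inj ->] // | eq_idx].
  have /val_inj : val (mxtens_index (k1, k2)) = val (mxtens_index (x, y)) := eq_idx.
  by move=> /(can_inj (@mxtens_indexK _ _)) [-> ->].
move=> eqMN; apply: eq_mx_ket => k; case: (mxtens_indexP k) => x y.
by rewrite -tens_ket eqMN.
Qed.

(** The bound excludes [b = c >= d], where [ket R d b] is zero and the left side vanishes. *)
Lemma ketbra_ket (R : realType) (d a b c : nat) : (b < d)%N ->
  ketbra R d a b *m ket R d c = (b == c)%:R *: ket R d a.
Proof.
move=> ltbd; rewrite -mulmxA; have -> : (ket R d b)^t* *m ket R d c = (b == c)%:R%:M.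
  rewrite -[b]/(val (Ordinal ltbd)); apply/matrixP => i j; rewrite !ord1 !mxE.
  rewrite (bigD1 (Ordinal ltbd)) //= big1 ?addr0 => [|k neq_k].
    by rewrite !mxE eqxx conjC1 mul1r mulr1n.
  by rewrite !mxE -[k == b :> nat]/(k == Ordinal ltbd) (negbTE neq_k) conjC0 mul0r.
by rewrite mul_mx_scalar.
Qed.

(** Collapses the sums of [ketbra] defining the gates once they act on a basis vector. *)
Lemma sum_nat_delta (K : pzRingType) (V : lmodType K) (m n x : nat)
    (g : nat -> V) :
  \sum_(m <= a < n) (a == x)%:R *: g a = (m <= x < n)%:R *: g x.
Proof.
have [x_in|x_notin] := boolP (m <= x < n)%N.
  rewrite (bigD1_seq x) ?mem_index_iota ?iota_uniq //= eqxx big1 ?addr0 // => a.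
  by move=> /negbTE ->; rewrite scale0r.
rewrite scale0r big_nat big1 // => a a_in; case: eqP => [eq_ax|]; last by rewrite scale0r.
by rewrite -eq_ax a_in in x_notin.
Qed.

Lemma Xgate_ket (R : realType) (d x : nat) : (x < d)%N ->
  Xgate R d *m ket R d x = ket R d (x.+1 %% d).
Proof.
case: d => // d ltxd; rewrite mulmxDl ketbra_ket // mulmx_suml.
under eq_big_nat => a /andP[_ ltad] do rewrite ketbra_ket ?leqW //.
rewrite sum_nat_delta /=; move: ltxd; rewrite ltnS.
(* Below the last index only the shift sum contributes; at the last index only the corner term does,
   giving the wrap-around to 0. *)
case: ltngtP => // [ltxd|->] _.
  by rewrite modn_small // scale0r add0r scale1r.
by rewrite modnn scale0r addr0 scale1r.
Qed.

Lemma XgateX_ket (R : realType) (d a x : nat) : (x < d)%N ->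
  Xgate R d ^+ a *m ket R d x = ket R d ((x + a) %% d).
Proof.
move=> ltxd; elim: a => [|a IHa]; first by rewrite expr0 mul1mx addn0 modn_small.
rewrite exprS -mulmxA IHa Xgate_ket ?ltn_mod ?(leq_ltn_trans _ ltxd) //.
by rewrite addnS; congr ket; rewrite -addn1 modnDml addn1.
Qed.

(** As [a] is invertible modulo [d], the map from [j] to [y + j * a] permutes the residues, so the
    product is merely reindexed. *)
Lemma prod_arith_progression (K : comPzRingType) (d a y : nat) (b : nat -> K) :
  coprime d a -> (0 < d)%N ->
  \prod_(j < d) b ((y + j * a) %% d)%N = \prod_(i < d) b i.
Proof.
move=> co_da d_gt0.
pose h (j : 'I_d) : 'I_d := Ordinal (ltn_pmod (y + j * a) d_gt0).
suff h_inj : injective h by rewrite [RHS](reindex_inj h_inj).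
move=> i j; wlog le_ij : i j / (i <= j)%N => [IH eq_ij|].
  by case/orP: (leq_total i j) => le_ij; [|symmetry]; apply: IH.
move/(congr1 val)/eqP; rewrite /= eqn_modDl eq_sym eqn_mod_dvd ?leq_mul2r ?le_ij ?orbT //.
(* Here [d] divides [(j - i) * a], hence [j - i], which is smaller than [d] and must be 0. *)
rewrite -mulnBl Gauss_dvdl // => dvd_ij; apply/val_inj/eqP.
rewrite eqn_leq le_ij /= -subn_eq0; apply: contraLR dvd_ij; rewrite -lt0n => lt0.
by rewrite gtnNdvd // (leq_ltn_trans (leq_subr _ _)).
Qed.

Lemma diag_mx_ket (R : realType) (d : nat) (B : 'M[R[i]]_d) (x : 'I_d) :
  is_diag_mx B -> B *m ket R d x = B x x *: ket R d x.
Proof.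
move=> /is_diag_mxP B_diag; rewrite mulmx_ketE; apply/colP => i; rewrite !mxE.
have [/ord_inj->|/B_diag->] := eqVneq (i : nat) x; first by rewrite mulr1.
by rewrite mulr0.
Qed.

(* [(X^a B)^k] sends [|y>] to the product of the entries of [B] met along
   [y, y + a, ...], times [|y + k a>]; for [k = d] every entry is met once. *)
Lemma XgateX_mul_diag_expd (R : realType) (d a : nat) (B : 'M[R[i]]_d) :
  is_diag_mx B -> coprime d a -> (Xgate R d ^+ a *m B) ^+ d = (\det B)%:M.
Proof.
case: d B => [|d] B B_diag co_da; first by rewrite [LHS]thinmx0 [RHS]thinmx0.
(* The diagonal is extended to all naturals so that it can be read at residues; the default of
   [inord] is never met, as every index used is below [d.+1]. *)
pose b k := B (inord k) (inord k).
have B_ket k : (k < d.+1)%N -> B *m ket R d.+1 k = b k *: ket R d.+1 k.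
  by move=> ltkd; rewrite -{1 3}(inordK ltkd) diag_mx_ket.
apply: eq_mx_ket => y; rewrite det_trig ?is_diag_mx_is_trig // mul_scalar_mx.
have -> : \prod_(i < d.+1) B i i = \prod_(i < d.+1) b i.
  by apply: eq_bigr => i _; rewrite /b inord_val.
(* The determinant is reordered along the orbit of [y], matching the product that [step]
   accumulates. *)
rewrite -(prod_arith_progression _ _ _ y b co_da) //.
have step k : (Xgate R d.+1 ^+ a *m B) ^+ k *m ket R d.+1 y =
    (\prod_(j < k) b ((y + j * a) %% d.+1)%N) *: ket R d.+1 ((y + k * a) %% d.+1).
  elim: k => [|k IHk].
    by rewrite expr0 mul1mx big_ord0 scale1r addn0 modn_small.
  rewrite exprS -mulmxA IHk -scalemxAr -mulmxA B_ket ?ltn_mod //.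
  rewrite -scalemxAr XgateX_ket ?ltn_mod // scalerA big_ord_recr /=.
  by rewrite modnDml -addnA -mulSnr.
rewrite step; congr (_ *: ket _ _ _).
by rewrite addnC mulnC modnMDl modn_small.
Qed.

(** An arbitrary [v], rather than a ket, lets the action be iterated inside the block of [x]. *)
Lemma SUMgate_ket (R : realType) (d x : nat) (v : 'cV[R[i]]_d) : (x < d)%N ->
  SUMgate R d *m (ket R d x *t v) = ket R d x *t (Xgate R d ^+ x *m v).
Proof.
move=> ltxd; rewrite mulmx_suml.
have tensZl c (u w : 'cV[R[i]]_d) : (c *: u) *t w = c *: (u *t w).
  by apply/matrixP => i j; rewrite !mxE mulrA.
under eq_big_nat => a /andP[_ ltad] do rewrite tensmx_mul ketbra_ket // tensZl.
by rewrite sum_nat_delta ltxd scale1r.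
Qed.

Lemma SUMgate_mul_tensX_ket (R : realType) (d x k : nat) (B : 'M[R[i]]_d)
    (v : 'cV[R[i]]_d) : (x < d)%N ->
  (SUMgate R d *m (1%:M *t B)) ^+ k *m (ket R d x *t v) =
  ket R d x *t ((Xgate R d ^+ x *m B) ^+ k *m v).
Proof.
move=> ltxd; elim: k => [|k IHk]; first by rewrite !expr0 !mul1mx.
by rewrite !exprS -!mulmxA IHk tensmx_mul mul1mx SUMgate_ket.
Qed.

Lemma Cgate_ket (R : realType) (d x : nat) (theta : R) : (x < d)%N ->
  Cgate d theta *m ket R d x =
  (if x == 0%N then expi (theta / d%:R) else 1) *: ket R d x.
Proof.
move=> ltxd; rewrite mulmxDl -scalemxAl ketbra_ket ?(leq_ltn_trans _ ltxd) //.
rewrite mulmx_suml.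
under eq_big_nat => a /andP[_ ltad] do rewrite ketbra_ket //.
rewrite sum_nat_delta ltxd andbT.
by case: x {ltxd} => [|x]; rewrite ?scale1r ?scale0r ?scaler0 ?addr0 ?add0r.
Qed.

Lemma expiN_mul (R : realType) (t : R) : expi t * expi (- t) = 1.
Proof.
apply/eqP; rewrite eq_complex /= cosN sinN mulrN opprK -!expr2 cos2Dsin2 eqxx.
by rewrite mulrN [sin t * _]mulrC addNr eqxx.
Qed.

Theorem mainTheorem4 (R : realType) (d : nat) (d_prime : prime d)
    (U : 'M[R[i]]_d) (U_unitary : U \is unitarymx)
    (theta : R) (theta_range : - pi < theta <= pi)
    (det_U : \det U = expi theta)
    (A D : 'M[R[i]]_d) (A_SU : special_unitary A) (D_diag : is_diag_mx D)
    (U_eq : U = A *m D *m A^t*)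
    (B : 'M[R[i]]_d) (B_SU : special_unitary B) (B_diag : is_diag_mx B)
    (B_eq : B ^+ d = expi (- (theta / d%:R)) *: D) :
  ctrl0 U = (Cgate d theta *t A)
            *m (SUMgate R d *m (1%:M *t B)) ^+ d
            *m (1%:M *t A^t*).
Proof.
have [/unitarymxP AAt _] := A_SU; have [_ det_B] := B_SU.
apply: eq_mx_ket_tens => x y; rewrite ctrl0_ket -!mulmxA tensmx_mul mul1mx.
rewrite SUMgate_mul_tensX_ket // tensmx_mul Cgate_ket //.
have tensZl c (u w : 'cV[R[i]]_d) : (c *: u) *t w = u *t (c *: w).
  by apply/matrixP => i j; rewrite !mxE mulrCA mulrA.
(* The phase of [Cgate] now sits on the second factor, where for [x = 0] it meets the opposite phase
   of [B ^+ d]. *)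
rewrite tensZl; case: eqP => [->|/eqP x_neq0].
  rewrite expr0 mul1mx B_eq -scalemxAl -scalemxAr scalerA expiN_mul scale1r.
  by rewrite U_eq !mulmxA.
rewrite XgateX_mul_diag_expd //; last first.
  by rewrite prime_coprime // gtnNdvd ?lt0n.
by rewrite det_B mul1mx mulmxA AAt mul1mx scale1r.
Qed.
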